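(* Let $X$ and $Y$ be real normed spaces such that $\dim(Y)<\infty$ and $d_{GH}(X,Y)<\infty$. Then $X$ is isometric to $Y$.
   Context: A normed space is regarded as a metric space with the metric induced by its norm; two metric spaces are isometric if there is a bijective distance-preserving map between them. The space $X$ is not assumed to be finite-dimensional or complete. For a subset $A$ of a metric space $Z$ and $r>0$, let $U_r(A)=\bigcup_{a\in A}\{z\in Z : |az|<r\}$, where $|az|$ is the distance between $a$ and $z$. The Hausdorff distance between non-empty subsets $A,B\subset Z$ is $d_H(A,B)=\inf\{r>0 : A\subset U_r(B),\ B\subset U_r(A)\}$ (with $\inf\emptyset=\infty$). The Gromov--Hausdorff distance $d_{GH}(X,Y)\in[0,\infty]$ between two arbitrary (not necessarily bounded) non-empty metric spaces $X,Y$ is the infimum of positive numbers $r$ such that there exist a metric space $Z$ and subsets $X',Y'\subset Z$ with $X'$ isometric to $X$, $Y'$ isometric to $Y$, and $d_H(X',Y')\leqslant r$ (with $\inf\emptyset=\infty$). *)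

(* Defs.v *)
From HB Require Import structures.
From mathcomp Require Import all_boot all_order all_algebra.
From mathcomp Require Import all_classical all_reals all_analysis.

Set Implicit Arguments.
Unset Strict Implicit.
Unset Printing Implicit Defensive.

Import Order.TTheory GRing.Theory Num.Theory.
Import numFieldNormedType.Exports.

Local Open Scope classical_set_scope.
Local Open Scope ring_scope.

(* A [normedModType] is not canonically a [metricType] in the library; this
   alias of [X] carries the metric induced by the norm. *)
Definition norm_metric {R : realType} (X : normedModType R) : Type := X.

Section NormMetric.
Context {R : realType} (X : normedModType R).

Let ndist (x y : X) : R := `|x - y|.

Let ndist_ge0 x y : 0 <= ndist x y.
Proof. exact: normr_ge0. Qed.

Let ndist_positivity x y : ndist x y = 0 -> x = y.
Proof. by move/normr0_eq0/eqP; rewrite subr_eq0 => /eqP. Qed.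

Let ballEndist (x : X) (d : R) : ball x d = [set y | ndist x y < d].
Proof. by rewrite -ball_normE. Qed.

HB.instance Definition _ := PseudoMetric.on (norm_metric X).
HB.instance Definition _ := @PseudoMetric_isMetric.Build R (norm_metric X)
  ndist ndist_ge0 ndist_positivity ballEndist.

End NormMetric.

Lemma norm_metricE {R : realType} (X : normedModType R)
  (x y : norm_metric X) : mdist x y = `|(x : X) - (y : X)|.
Proof. by []. Qed.

Section GromovHausdorff.
Context {R : realType}.

Definition isometric (X Y : metricType R) : Prop :=
  exists f : X -> Y,
    bijective f /\ forall x y, mdist (f x) (f y) = mdist x y.

(* [isometric] for a subset [A] of [Z] seen as a metric space with the distance
   of [Z]: the bijection onto the subspace is given as a map into [Z]. *)
Definition isometric_to_subset (X Z : metricType R) (A : set Z) : Prop :=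
  exists f : X -> Z,
    set_bij [set: X] A f /\ forall x y, mdist (f x) (f y) = mdist x y.

Definition neighborhood (Z : metricType R) (r : R) (A : set Z) : set Z :=
  \bigcup_(a in A) [set z | mdist a z < r].

(* [ereal_inf set0] is [+oo]. *)
Definition hausdorff_dist (Z : metricType R) (A B : set Z) : \bar R :=
  ereal_inf [set r%:E | r in
    [set r : R | [/\ 0 < r, A `<=` neighborhood r B & B `<=` neighborhood r A]]].

Definition gromov_hausdorff_dist (X Y : metricType R) : \bar R :=
  ereal_inf [set r%:E | r in
    [set r : R | 0 < r /\
      exists (Z : metricType R) (X' Y' : set Z),
        [/\ isometric_to_subset X X', isometric_to_subset Y Y' &
            (hausdorff_dist X' Y' <= r%:E)%E]]].

End GromovHausdorff.

(* [Vector.axiom n V] is the type of linear bijections from [V] to [R^n]. *)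
Definition finite_dimensional {R : realType} (V : lmodType R) : Prop :=
  exists n : nat, inhabited (Vector.axiom n V).

(* Main.v *)
(* A finite Gromov-Hausdorff distance yields f : X -> Y and g : Y -> X such that
   f distorts distances by at most C and f o g is C-close to the identity.
   Rescaling kills the errors: since closed balls of Y are compact, the bounded
   sequences f (k x) / k converge along an ultrafilter on nat to some F x, and
   F : X -> Y preserves distances. Hence the unit ball of X has a finite 1/2-net
   s_1, ..., s_n; iterating x = s_i + x' / 2 with |x'| <= 1 approximates
   every x in that ball by combinations of the s_i with coefficients in [0, 2],
   so closed balls of X are compact as well. The limit of g (k y) / k along the
   ultrafilter then exists and is a preimage of y under F. *)
Require Import Defs.
From mathcomp Require Import all_boot all_order all_algebra.
From mathcomp Require Import all_classical all_reals all_analysis.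
From mathcomp Require Import lra.

Set Implicit Arguments.
Unset Strict Implicit.
Unset Printing Implicit Defensive.

Import Order.TTheory GRing.Theory Num.Theory.
Import numFieldNormedType.Exports.

Local Open Scope classical_set_scope.
Local Open Scope ring_scope.

(** * Limits along ultrafilters in compact sets *)

Lemma ultra_compact_cvg {T : Type} {V : topologicalType} (U : set_system T)
    (K : set V) (u : T -> V) :
  UltraFilter U -> compact K -> (forall t, K (u t)) ->
  exists l : V, u t @[t --> U] --> l.
Proof.
move=> UU cK Ku; have PU := @ultra_proper _ _ UU.
have [|p [_ clp]] := cK (fmap u U) (fmap_proper_filter u PU).
  exact: (@filterE _ U _ (u @^-1` K)) Ku.
exists p => B Bp; have [//|UB] := in_ultra_setVsetC (u @^-1` B) UU.
by have [y []] := clp (~` B) B UB Bp.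
Qed.

Lemma closed_norm_le {R : realType} (V : normedModType R) (r : R) :
  closed [set x : V | `|x| <= r].
Proof.
rewrite (_ : mkset _ = closed_ball_ Num.norm 0 r).
  exact: closed_closed_ball_.
by apply/seteqP; split => x; rewrite /closed_ball_/= sub0r normrN.
Qed.

(** * Compactness of balls via finite linear combinations *)

Section LinearCombination.
Context {R : realType} {V : normedModType R} {n : nat} (s : 'I_n -> V).

Definition lincomb (a : 'rV[R]_n) : V := \sum_i a 0 i *: s i.

Lemma lincombD a b : lincomb (a + b) = lincomb a + lincomb b.
Proof.
by rewrite -big_split; apply: eq_bigr => i _; rewrite mxE scalerDl.
Qed.

Lemma lincombZ k a : lincomb (k *: a) = k *: lincomb a.
Proof.
by rewrite scaler_sumr; apply: eq_bigr => i _; rewrite mxE scalerA.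
Qed.

Lemma lincomb_delta i : lincomb (delta_mx 0 i) = s i.
Proof.
rewrite /lincomb (bigD1 i)//= mxE !eqxx scale1r big1 ?addr0// => j ji.
by rewrite mxE (negbTE ji) andbF scale0r.
Qed.

Lemma lincomb_continuous : continuous lincomb.
Proof.
apply: continuous_big => [|i _ a]; first exact: add_continuous.
exact: cvgZr_tmp (@coord_continuous _ _ _ 0 i a).
Qed.

Lemma compact_lincomb r : compact (lincomb @` [set a | `|a| <= r]).
Proof.
apply: continuous_compact; first exact/continuous_subspaceT/lincomb_continuous.
apply: bounded_closed_compact.
  exists r; split; first exact: num_real.
  by move=> M rM a /= /le_trans; apply; exact: ltW.
exact: closed_norm_le.
Qed.

Lemma compact_ball_lincomb C :
  [set x | `|x| <= 1] `<=` lincomb @` [set a | `|a| <= C] ->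
  forall r, compact [set x : V | `|x| <= r].
Proof.
(* This [t] is positive and at least [r] even when [r] is negative, so division by [t] maps the ball
   of radius [r] into the unit ball. *)
move=> sC r; set t : R := `|r| + 1.
have t0 : 0 < t by rewrite /t ltr_wpDl.
apply: (subclosed_compact _ (@compact_lincomb (t * C))).
  exact: closed_norm_le.
move=> x /= xr; have [|a aC ax] := sC (t^-1 *: x).
  rewrite /= normrZ gtr0_norm ?invr_gt0// ler_pdivrMl// mulr1.
  by rewrite (le_trans xr)// /t (le_trans (ler_norm r))// lerDl.
exists (t *: a); first by rewrite /= normrZ gtr0_norm// ler_pM2l.
by rewrite lincombZ ax scalerA divff ?gt_eqF// scale1r.
Qed.

Lemma compact_ball_half_net :
  (forall x, `|x| <= 1 -> exists i, `|x - s i| <= 2^-1) ->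
  forall r, compact [set x : V | `|x| <= r].
Proof.
move=> net; apply: (@compact_ball_lincomb 2) => x /= x1.
(* The bound 2 is the fixed point of [c = 1 + c / 2]: each round adds a basis vector of norm at most
   1 to half of the previous coefficients, while the error is halved. *)
have approx k : forall y, `|y| <= 1 ->
    exists2 a : 'rV_n, `|a| <= 2 & `|y - lincomb a| <= 2^-1 ^+ k.
  elim: k => [|k IH] y y1.
    exists 0; first by rewrite normr0.
    by rewrite -(scale0r 0) lincombZ scale0r subr0 expr0.
  have [i yi] := net _ y1.
  have [|a a2 ya] := IH (2 *: (y - s i)).
    by rewrite normrZ ger0_norm// -ler_pdivlMl// mulr1.
  exists (delta_mx 0 i + 2^-1 *: a).
    apply: le_trans (ler_normD _ _) _; rewrite normrZ.
    have : `|delta_mx 0 i : 'rV[R]_n| <= 1.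
      rewrite [leLHS]mx_normrE; apply/bigmax_leP; split => // -[j k'] _ /=.
      by rewrite mxE; case: (_ && _); rewrite ?normr1 ?normr0.
    rewrite ger0_norm; lra.
  rewrite lincombD lincombZ lincomb_delta.
  have -> : y - (s i + 2^-1 *: lincomb a) =
      2^-1 *: (2 *: (y - s i) - lincomb a).
    by rewrite scalerBr scalerA mulVf// scale1r opprD addrA.
  by rewrite normrZ exprS ger0_norm// ler_pM2l.
(* The approximations put [x] in the closure of this image, which is compact and therefore
   closed. *)
have cl : closed (lincomb @` [set a | `|a| <= 2]).
  by apply: compact_closed; [exact: norm_hausdorff|exact: compact_lincomb].
apply: cl => B /nbhs_ballP[e /= e0 eB].
have [k ke] : exists k, 2^-1 ^+ k < e.
  have : (2^-1 ^+ k : R) @[k --> \oo] --> 0.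
    by apply: cvg_expr; rewrite ger0_norm//; lra.
  move=> /cvgr0_norm_lt /(_ _ e0)[N _ /(_ N (leqnn N))/= h].
  by exists N; rewrite (le_lt_trans (ler_norm _)).
have [a a2 xa] := approx k _ x1.
exists (lincomb a); split; first by exists a.
by apply: eB; rewrite -ball_normE/=; exact: le_lt_trans xa ke.
Qed.

End LinearCombination.

(** The inverse of the coordinate map is [lincomb s]. By injectivity, its norm has a positive
    minimum on the compact unit sphere of coefficients, which bounds the coordinates of the unit
    ball. *)
Lemma finite_dimensional_compact_ball {R : realType} (V : normedModType R) :
  finite_dimensional V -> forall r, compact [set x : V | `|x| <= r].
Proof.
move=> [n [[v linv [g vK gK]]]].
pose s i := g (delta_mx 0 i).
have v0 : v 0 = 0.
  have := linv (-1) 0 0; rewrite scaler0 addr0 scaleN1r addNr; exact.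
have vD x y : v (x + y) = v x + v y.
  by have := linv 1 x y; rewrite !scale1r.
have vZ k x : v (k *: x) = k *: v x.
  by have := linv k x 0; rewrite !(v0, addr0).
have vs a : v (lincomb s a) = a.
  rewrite /lincomb (big_morph v vD v0) [RHS]row_sum_delta.
  by apply: eq_bigr => i _; rewrite vZ gK.
have sv x : lincomb s (v x) = x by apply: (can_inj vK); rewrite vs.
pose S := [set a : 'rV[R]_n | `|a| = 1].
have cS : compact S.
  apply: bounded_closed_compact.
    exists 1; split; first exact: num_real.
    by move=> M M1 a Sa /=; apply: le_trans (ltW M1); rewrite Sa.
  rewrite (_ : S = Num.norm @^-1` [set 1]); last by [].
  apply: preimage_closed; last exact: closed_eq.
  by move=> a _; exact: norm_continuous.
have [C HC] : exists C, forall a : 'rV_n, `|lincomb s a| <= 1 -> `|a| <= C.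
  have nS a : a != 0 -> S (`|a|^-1 *: a).
    by move=> a0; rewrite /S/= normrZ normfV normr_id mulVf// normr_eq0.
  (* In dimension 0 the sphere is empty and there is no minimum to take. *)
  have [S0|S0] := pselect (S !=set0); last first.
    exists 0 => a _; have [->|/nS Sa] := eqVneq a 0; first by rewrite normr0.
    by exfalso; apply: S0; exists (`|a|^-1 *: a).
  have [|c] := @compact_EVT_min _ R (fun a => `|lincomb s a|) S S0 cS.
    apply: continuous_subspaceT => a.
    exact: cvg_norm (@lincomb_continuous _ _ _ s a).
  rewrite inE => cS1 cmin; set m := `|lincomb s c| in cmin *.
  have m0 : 0 < m.
    rewrite normr_gt0; apply/eqP => c0; have := vs c; rewrite c0 v0 => c0'.
    by move: cS1; rewrite /S/= -c0' normr0 => /eqP; rewrite eq_sym oner_eq0.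
  exists m^-1 => a a1; have [->|a0] := eqVneq a 0.
    by rewrite normr0 invr_ge0 ltW.
  have := cmin (`|a|^-1 *: a); rewrite inE => /(_ (nS _ a0)).
  have na : 0 < `|a| by rewrite normr_gt0.
  rewrite lincombZ normrZ normfV normr_id ler_pdivlMl// => h.
  by rewrite -[leRHS]mul1r ler_pdivlMr// (le_trans h).
apply: (@compact_ball_lincomb _ _ _ s C) => x /= x1.
by exists (v x); rewrite ?sv//; apply: HC; rewrite sv.
Qed.

(** * From coarse isometries to isometries *)

Lemma isometric_half_net {R : realType} (X Y : normedModType R) (F : X -> Y) :
  (forall r, compact [set y : Y | `|y| <= r]) ->
  (forall x x', `|F x - F x'| = `|x - x'|) ->
  exists n (s : 'I_n -> X), forall x, `|x| <= 1 -> exists i, `|x - s i| <= 2^-1.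
Proof.
move=> cY isoF; pose near_image y := [set x | `|y - F x| < 4^-1].
have := cY (1 + `|F 0|); rewrite compact_cover.
move=> /(_ Y setT (fun y => ball y 4^-1)) [y _||D _ KD].
- by apply: ball_open; rewrite invr_gt0.
- by move=> y _; exists y => //; apply: ballxx; rewrite invr_gt0.
pose e := finmap.enum_fset D.
(* The centres of the 1/4-balls need not lie in the image of [F]. Each is replaced by a point of [X]
   whose image is 1/4-close to it, or by 0 if there is none; the errors add up to 1/2. *)
exists (size e), (fun i => xget 0 (near_image (tnth (in_tuple e) i))) => x x1.
have [|y /= /seq_tnthP[i ->]] := KD (F x).
  have := isoF x 0; rewrite subr0 => xF.
  by rewrite /= -(subrK (F 0) (F x)) (le_trans (ler_normD _ _))// xF lerD2r.
rewrite -ball_normE/= => yx; exists i.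
set y' := tnth _ _ in yx *.
set x' := xget _ _.
have yx' : `|y' - F x'| < 4^-1.
  by have : near_image y' x' by apply: xgetPex; exists x.
rewrite -isoF -(subrK y' (F x)) -addrA (le_trans (ler_normD _ _))//.
by rewrite (distrC (F x)); lra.
Qed.

(** The scale is [k.+1] rather than [k] so that it is always invertible. *)
Definition blowdown {R : realType} {V W : normedModType R} (h : V -> W)
    (k : nat) (v : V) : W :=
  k.+1%:R^-1 *: h (k.+1%:R *: v).

Section CoarseIsometry.
Context {R : realType} {X Y : normedModType R}.
Context (f : X -> Y) (g : Y -> X) (C : R).
Context (f_coarse : forall x x', `| `|f x - f x'| - `|x - x'| | <= C).
Context (fg_close : forall y, `|f (g y) - y| <= C).

Let C_ge0 : 0 <= C.
Proof. exact: le_trans (fg_close 0). Qed.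

Let small_error (k : nat) : k.+1%:R^-1 * C <= C.
Proof. by rewrite ler_piMl// invf_le1// ler1n. Qed.

Let norm_inv_scale (V : normedModType R) (k : nat) (v : V) :
  `|(k.+1%:R^-1 : R) *: v| = k.+1%:R^-1 * `|v|.
Proof. by rewrite normrZ ger0_norm ?invr_ge0. Qed.

Lemma blowdown_coarse k x x' :
  `| `|blowdown f k x - blowdown f k x'| - `|x - x'| | <= k.+1%:R^-1 * C.
Proof.
set t : R := k.+1%:R.
have -> : x - x' = t^-1 *: (t *: x - t *: x').
  by rewrite scalerBr !scalerA mulVf ?pnatr_eq0// !scale1r.
have -> : blowdown f k x - blowdown f k x' = t^-1 *: (f (t *: x) - f (t *: x')).
  by rewrite scalerBr.
rewrite !norm_inv_scale -mulrBr normrM ger0_norm ?invr_ge0//.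
by rewrite ler_wpM2l ?invr_ge0.
Qed.

Lemma blowdown_close k y :
  `|blowdown f k (blowdown g k y) - y| <= k.+1%:R^-1 * C.
Proof.
set t : R := k.+1%:R.
have -> : blowdown f k (blowdown g k y) - y = t^-1 *: (f (g (t *: y)) - t *: y).
  rewrite scalerBr scalerA mulVf ?pnatr_eq0// scale1r.
  by rewrite /blowdown scalerA divff ?pnatr_eq0// scale1r.
by rewrite norm_inv_scale ler_wpM2l ?invr_ge0.
Qed.

Lemma blowdown_bounded x : exists r, forall k, `|blowdown f k x| <= r.
Proof.
exists (`|x| + C + `|f 0|) => k.
rewrite -(subrK (blowdown f k 0) (blowdown f k x)).
apply: le_trans (ler_normD _ _) _; apply: lerD.
  have := blowdown_coarse k x 0; rewrite subr0 ler_distl => /andP[_].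
  by move=> /le_trans; apply; rewrite lerD2l.
rewrite /blowdown scaler0 normrZ ger0_norm ?invr_ge0//.
by rewrite ler_piMl// invf_le1// ler1n.
Qed.

(** No distortion bound is given for [g], so the estimate goes through [f]: the rescaled [f] sends
    [blowdown g k y] close to [y], and it changes distances to 0 by at most [C]. *)
Lemma blowdown_inverse_bounded y : exists r, forall k, `|blowdown g k y| <= r.
Proof.
have [r hr] := blowdown_bounded 0; exists (C + C + r + `|y|) => k.
have := le_trans (blowdown_coarse k (blowdown g k y) 0) (small_error k).
have := le_trans (blowdown_close k y) (small_error k).
have := ler_normB (blowdown f k (blowdown g k y)) (blowdown f k 0).
have := ler_normD (blowdown f k (blowdown g k y) - y) y.
have := hr k; rewrite subrK subr0 ler_distl => ? ? ? ? /andP[].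
lra.
Qed.

Lemma coarse_isometry_isometric :
  (forall r, compact [set y : Y | `|y| <= r]) ->
  exists F : X -> Y, bijective F /\ forall x x', `|F x - F x'| = `|x - x'|.
Proof.
(* A single ultrafilter serves all points, so limits at different points can be compared without
   extracting subsequences. *)
move=> cY; have [U [UU ooU]] := @ultraFilterLemma nat \oo _.
have PU := @ultra_proper _ _ UU.
have lim_bounded (V : normedModType R) (u : nat -> V) :
    (forall r, compact [set v : V | `|v| <= r]) ->
    (exists r, forall k, `|u k| <= r) -> exists l : V, u k @[k --> U] --> l.
  by move=> cV [r ur]; exact: ultra_compact_cvg UU (cV r) ur.
have err0 : k.+1%:R^-1 * C @[k --> U] --> (0 : R).
  rewrite -(mul0r C); apply: cvgMr_tmp.
  exact: cvg_trans (cvg_app _ ooU) cvg_harmonic.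
have /choice[F limF] x : exists l : Y, blowdown f k x @[k --> U] --> l.
  exact: lim_bounded cY (blowdown_bounded x).
have isoF x x' : `|F x - F x'| = `|x - x'|.
  have lim1 : `|blowdown f k x - blowdown f k x'| @[k --> U] --> `|F x - F x'|.
    by apply: cvg_norm; apply: cvgB.
  have lim2 : `|blowdown f k x - blowdown f k x'| @[k --> U] --> `|x - x'|.
    apply: (@squeeze_cvgr _ _ _ _ (fun k => `|x - x'| - k.+1%:R^-1 * C)
      (fun k => `|x - x'| + k.+1%:R^-1 * C)).
    - by apply: filterE => k; rewrite -ler_distl; exact: blowdown_coarse.
    - by rewrite -[X in _ --> X]subr0; apply: cvgB => //; exact: cvg_cst.
    - by rewrite -[X in _ --> X]addr0; apply: cvgD => //; exact: cvg_cst.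
  exact: cvg_unique lim1 lim2.
have cX : forall r, compact [set x : X | `|x| <= r].
  have [n [s net]] := isometric_half_net cY isoF.
  exact: compact_ball_half_net net.
have /choice[G limG] y : exists l : X, blowdown g k y @[k --> U] --> l.
  exact: lim_bounded cX (blowdown_inverse_bounded y).
have FG y : F (G y) = y.
  have lim0 : `|blowdown f k (G y) - y| @[k --> U] --> (0 : R).
    (* Pass through the rescaled [f] at [blowdown g k y]: one error term is the distortion of [f],
       the other the closeness of [f] after [g] to the identity. *)
    apply: (@squeeze_cvgr _ _ _ _ (fun=> 0) (fun k => `|G y - blowdown g k y|
      + k.+1%:R^-1 * C + k.+1%:R^-1 * C)).
    - apply: filterE => k; rewrite normr_ge0/=.
      rewrite -(subrK (blowdown f k (blowdown g k y)) (blowdown f k (G y))).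
      rewrite -addrA (le_trans (ler_normD _ _))// lerD ?blowdown_close//.
      have := blowdown_coarse k (G y) (blowdown g k y).
      by rewrite ler_distl => /andP[].
    - exact: cvg_cst.
    - rewrite -[X in _ --> X]addr0 -[X in _ --> X + _]addr0.
      apply: cvgD => //; apply: cvgD => //.
      rewrite -(normr0 X) -(subrr (G y)); apply: cvg_norm.
      by apply: cvgB => //; exact: cvg_cst.
  have lim1 : `|blowdown f k (G y) - y| @[k --> U] --> `|F (G y) - y|.
    by apply: cvg_norm; apply: cvgB => //; exact: cvg_cst.
  by apply/eqP; rewrite -subr_eq0 -normr_eq0 (cvg_unique _ lim1 lim0).
(* [G] is also a left inverse, since [F] preserves distances and [F (G (F x)) = F x]. *)
exists F; split => //; exists G => // x; apply/eqP.
by rewrite -subr_eq0 -normr_eq0 -isoF FG subrr normr0.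
Qed.

End CoarseIsometry.

(** * Coarse isometries from a finite Gromov-Hausdorff distance *)

Lemma gromov_hausdorff_coarse_isometry {R : realType} (X Y : metricType R) :
  (gromov_hausdorff_dist X Y < +oo)%E ->
  exists (f : X -> Y) (g : Y -> X) (C : R),
    (forall x x', `|mdist (f x) (f x') - mdist x x'| <= C) /\
    (forall y, mdist (f (g y)) y <= C).
Proof.
move=> /ereal_inf_lt[_ [r0 [_ [Z [X' [Y' [iX iY dXY]]]]] <-] _].
have {iX}[i [[iX' _ X'i] di]] := iX; have {iY}[j [[jY' _ Y'j] dj]] := iY.
(* Only finiteness of the Hausdorff distance is extracted: [r] is some admissible radius, not
   necessarily at most [r0]. *)
have /ereal_inf_lt[_ [r [_ XY YX] <-] _] := le_lt_trans dXY (ltry r0).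
have /choice[f if_near] x : exists y, mdist (i x) (j y) < r.
  have [_ /Y'j[y _ <-] yx] := XY _ (iX' x I).
  by exists y; rewrite metric_sym.
have /choice[g jg_near] y : exists x, mdist (i x) (j y) < r.
  by have [_ /X'i[x _ <-]] := YX _ (jY' y I); exists x.
(* Each estimate moves twice between a point of [X'] and an [r]-close point of [Y'], hence the
   constant [r + r]. *)
exists f, g, (r + r); split=> [x x'|y].
  rewrite ler_distl -di -dj.
  have := metric_triangle (i x) (j (f x)) (i x').
  have := metric_triangle (j (f x)) (j (f x')) (i x').
  have := metric_triangle (j (f x)) (i x) (j (f x')).
  have := metric_triangle (i x) (i x') (j (f x')).
  have := if_near x; have := if_near x'.
  rewrite (metric_sym (j (f x)) (i x)) (metric_sym (j (f x')) (i x')); lra.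
rewrite -dj (le_trans (metric_triangle _ (i (g y)) _))// metric_sym.
by rewrite lerD// ltW.
Qed.

Theorem theorem12 (R : realType) (X Y : normedModType R)
    (hY : finite_dimensional Y)
    (hXY : (gromov_hausdorff_dist (norm_metric X) (norm_metric Y) < +oo)%E) :
  isometric (norm_metric X) (norm_metric Y).
Proof.
have [f [g [C [f_coarse fg_close]]]] := gromov_hausdorff_coarse_isometry hXY.
exact: coarse_isometry_isometric f_coarse fg_close
  (finite_dimensional_compact_ball hY).
Qed.
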